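(* For each $\beta\in\mathbb{R}$ and each $(\theta_1,\theta_2)\in(0,1)^2$, the function $\Phi_\beta(\theta_1,\theta_2;\cdot):I_{\theta_1,\theta_2}\to\mathbb{R}$ is strictly convex, and its unique critical point is given by $$t=R_\beta(\theta_1,\theta_2):=-\frac1\beta\ln\left(1-\frac{(1-e^{-\beta\theta_1})(1-e^{-\beta\theta_2})}{1-e^{-\beta}}\right),$$ where for $\beta=0$ the right-hand side is read as its limit $\theta_1\theta_2$ as $\beta\to0$.
   Context: $p(\beta)=\int_0^1\ln\left(\frac{1-e^{-\beta x}}{\beta x}\right)dx$ for $\beta\in\mathbb{R}$, with the continuous extension $p(0)=0$. $L_1(\theta)=[0,\theta]$, $L_2(\theta)=(\theta,1]$, $\Lambda_{ij}=L_i(\theta_1)\times L_j(\theta_2)$ for $i,j\in\{1,2\}$, and $|\Lambda_{ij}|$ is its Lebesgue measure (area). For $t_{11},t_{12},t_{21},t_{22}\ge0$ with $t_{11}+t_{12}+t_{21}+t_{22}=1$, define (with $0\ln0=0$) $$\begin{aligned}\widetilde{\Phi}_\beta(\theta_1,\theta_2;t_{11},t_{12},t_{21},t_{22}) =\;& p(\beta)+\sum_{i,j=1}^2 t_{ij}\ln\left(\frac{t_{ij}}{|\Lambda_{ij}|}\right)+\sum_{i,j=1}^2 t_{ij}\,p(\beta t_{ij})\\ &-(t_{11}+t_{12})\,p(\beta(t_{11}+t_{12}))-(t_{11}+t_{21})\,p(\beta(t_{11}+t_{21}))\\ &-(t_{12}+t_{22})\,p(\beta(t_{12}+t_{22}))-(t_{21}+t_{22})\,p(\beta(t_{21}+t_{22}))+\beta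 t_{12}t_{21}.\end{aligned}$$ $I_{\theta_1,\theta_2}=[\max\{0,\theta_1+\theta_2-1\},\min\{\theta_1,\theta_2\}]$, and for $t\in I_{\theta_1,\theta_2}$, $$\Phi_\beta(\theta_1,\theta_2;t)=\widetilde{\Phi}_\beta(\theta_1,\theta_2;t,\theta_1-t,\theta_2-t,1-\theta_1-\theta_2+t).$$ *)

(* Defs.v *)
From HB Require Import structures.
From mathcomp Require Import all_boot all_order all_algebra.
From mathcomp Require Import all_classical all_reals all_analysis.

Set Implicit Arguments.
Unset Strict Implicit.
Unset Printing Implicit Defensive.

Import Order.TTheory GRing.Theory Num.Theory.
Import numFieldNormedType.Exports.

Local Open Scope classical_set_scope.
Local Open Scope ring_scope.

(* At x = 0 the integrand takes a conventional value, on a Lebesgue-null set. *)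
Definition pressure {R : realType} (beta : R) : R :=
  if beta == 0 then 0
  else \int[lebesgue_measure]_(x in `[0, 1])
         ln ((1 - expR (- (beta * x))) / (beta * x)).

Definition L1 {R : realType} (theta : R) : set R := `[0, theta]%classic.
Definition L2 {R : realType} (theta : R) : set R := `]theta, 1]%classic.

Definition area {R : realType} (A B : set R) : R :=
  fine ((lebesgue_measure \x lebesgue_measure)%E (A `*` B)).

(* When t = 0 the product is 0, so the convention 0 ln 0 = 0 holds. *)
Definition entropy_term {R : realType} (t a : R) : R := t * ln (t / a).

(* A total function, meant for nonnegative tij that sum to 1. *)
Definition Phi_tilde {R : realType} (beta theta1 theta2 t11 t12 t21 t22 : R)
    : R :=
  let p := @pressure R in
  p beta
  + (entropy_term t11 (area (L1 theta1) (L1 theta2))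
     + entropy_term t12 (area (L1 theta1) (L2 theta2))
     + entropy_term t21 (area (L2 theta1) (L1 theta2))
     + entropy_term t22 (area (L2 theta1) (L2 theta2)))
  + (t11 * p (beta * t11) + t12 * p (beta * t12)
     + t21 * p (beta * t21) + t22 * p (beta * t22))
  - (t11 + t12) * p (beta * (t11 + t12))
  - (t11 + t21) * p (beta * (t11 + t21))
  - (t12 + t22) * p (beta * (t12 + t22))
  - (t21 + t22) * p (beta * (t21 + t22))
  + beta * t12 * t21.

Definition Idom {R : realType} (theta1 theta2 : R) : set R :=
  `[Num.max 0 (theta1 + theta2 - 1), Num.min theta1 theta2]%classic.

(* Only the values for t in Idom theta1 theta2 are meaningful. *)
Definition Phi {R : realType} (beta theta1 theta2 t : R) : R :=
  Phi_tilde beta theta1 theta2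
    t (theta1 - t) (theta2 - t) (1 - theta1 - theta2 + t).

Definition strictly_convex_on {R : realType} (D : set R) (f : R -> R) : Prop :=
  forall x y lambda : R, D x -> D y -> x != y -> 0 < lambda < 1 ->
    f (lambda * x + (1 - lambda) * y) < lambda * f x + (1 - lambda) * f y.

(* A critical point of a function on D is an interior point of D where the
   derivative exists and vanishes; f may be arbitrary outside D. *)
Definition critical_point {R : realType} (D : set R) (f : R -> R) (t : R)
    : Prop :=
  interior D t /\ is_derive t 1 f 0.

(* The value at beta = 0 is the limit of the formula as beta tends to 0. *)
Definition Rcrit {R : realType} (beta theta1 theta2 : R) : R :=
  if beta == 0 then theta1 * theta2
  else - beta^-1 *
       ln (1 - (1 - expR (- (beta * theta1))) * (1 - expR (- (beta * theta2)))
               / (1 - expR (- beta))).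

(* Main.v *)
(* Put q(y) = (e^y - 1)/y and F(u) = u p(beta u). Since
   p(beta) = int_0^1 ln q(-beta x) dx, the substitution s = u x gives
   F(u) = int_0^u ln q(-beta s) ds, so F'(u) = ln q(-beta u). Hence, the areas
   cancelling because |L11| |L22| = |L12| |L21|, and with
   ln q(y) = y + ln q(-y) absorbing the term beta t12 t21,
     Phi'(t) = ln g_-(t11) + ln g_-(t22) - ln g_+(t12) - ln g_+(t21)
   where g_-(s) = (1 - e^(-beta s))/beta and g_+(s) = (e^(beta s) - 1)/beta are
   positive and increasing. As t grows, t11 and t22 grow while t12 and t21
   shrink, so Phi' is strictly increasing. Finally
   Phi' = 0 means g_-(t11) g_-(t22) = g_+(t12) g_+(t21), which is a linear
   equation in e^(-beta t). *)
Require Import Defs.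
From HB Require Import structures.
From mathcomp Require Import all_boot all_order all_algebra.
From mathcomp Require Import all_classical all_reals all_analysis.
From mathcomp Require Import ring lra.

Import Order.TTheory GRing.Theory Num.Theory.
Import numFieldNormedType.Exports.

Local Open Scope classical_set_scope.
Local Open Scope ring_scope.

(** * The quotient (e^y - 1) / y and its logarithm *)

(** The value 1 at 0 is the limit there, so that [beta = 0] shares the calculus of all other
    [beta]. *)
Definition expq {R : realType} (y : R) : R :=
  if y == 0 then 1 else (expR y - 1) / y.

Lemma expq0 {R : realType} : expq (0 : R) = 1.
Proof. by rewrite /expq eqxx. Qed.

Lemma mulr_expq {R : realType} (y : R) : y * expq y = expR y - 1.
Proof.
rewrite /expq; case: eqVneq => [->|y0]; first by rewrite mul0r expR0 subrr.
by rewrite mulrC divfK.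
Qed.

Lemma expq_gt0 {R : realType} (y : R) : 0 < expq y.
Proof.
rewrite /expq; case: (ltgtP y 0) => [y0|y0|_] //.
- by rewrite nmulr_rgt0 ?invr_lt0// subr_lt0 expR_lt1.
- by rewrite divr_gt0// subr_gt0 expR_gt1.
Qed.

Lemma expqN {R : realType} (y : R) : expq y = expR y * expq (- y).
Proof.
case: (eqVneq y 0) => [->|y0]; first by rewrite oppr0 expR0 mul1r.
apply: (mulfI y0); rewrite mulrCA -[y * expq (- y)]opprK -mulNr !mulr_expq.
by rewrite mulrN mulrBr -expRD subrr expR0 mulr1 opprB.
Qed.

Lemma ln_expqN {R : realType} (y : R) : ln (expq y) = y + ln (expq (- y)).
Proof.
by rewrite expqN lnM ?expRK// posrE ?expR_gt0 ?expq_gt0.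
Qed.

Lemma continuous_expq {R : realType} : continuous (@expq R).
Proof.
move=> y; case: (eqVneq y 0) => [->|y0].
(* For h != 0, [expq h] is the difference quotient of exp at 0, whose limit is exp'(0) = 1. *)
- apply/continuous_withinNx; rewrite expq0.
  have [] := is_derive_expR (0 : R); rewrite /derivable /derive expR0 => + dE.
  rewrite dE; apply: cvg_trans.
  apply: near_eq_cvg; near=> h.
  have h0 : h != 0 by near: h; exact: nbhs_dnbhs_neq.
  rewrite /expq (negbTE h0) /= [_ *: 1]mulr1 addr0.
  by rewrite [LHS]mulrC.
- have : {for y, continuous (fun z : R => (expR z - 1) / z)}.
    apply: cvgM; last by apply: cvgV => //; exact: cvg_id.
    by apply: cvgB; [exact: continuous_expR|exact: cvg_cst].
  rewrite /prop_for /continuous_at [X in _ -> _ --> X]/expq (negbTE y0).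
  apply: cvg_trans; apply: near_eq_cvg; near=> h.
  have h0 : h != 0.
    near: h.
    by apply: (@cvgr_neq0 _ _ _ (nbhs y) _ id y); first exact: cvg_id.
  by rewrite /expq (negbTE h0).
Unshelve. all: by end_near. Qed.

Lemma continuous_ln_expq {R : realType} (c : R) :
  continuous (fun x => ln (expq (c * x))).
Proof.
move=> x; apply: continuous_cvg; first exact/continuous_ln/expq_gt0.
apply: continuous_cvg; first exact: continuous_expq.
exact: mulrl_continuous.
Qed.

(** This is g_+ for c = beta and g_- for c = -beta; both become the identity at beta = 0. *)
Lemma mulr_expqM {R : realType} (c s : R) :
  s * expq (c * s) = if c == 0 then s else (expR (c * s) - 1) / c.
Proof.
case: (eqVneq c 0) => [->|c0]; first by rewrite mul0r expq0 mulr1.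
by rewrite -mulr_expq -[c * s * _]mulrA [RHS]mulrC mulKf.
Qed.

(** For c < 0, both s -> e^(c s) and division by c reverse the order, so the two reversals
    cancel. *)
Lemma ln_mulr_expq_increasing {R : realType} (c s1 s2 : R) :
  0 < s1 -> s1 < s2 -> ln (s1 * expq (c * s1)) < ln (s2 * expq (c * s2)).
Proof.
move=> s10 s12; have s20 := lt_trans s10 s12.
rewrite ltr_ln ?posrE ?mulr_gt0 ?expq_gt0//.
rewrite !mulr_expqM; case: (ltgtP c 0) => [c0|c0|_] //.
- by rewrite ltr_nM2r ?invr_lt0// ltrD2r ltr_expR ltr_nM2l.
- by rewrite ltr_pM2r ?invr_gt0// ltrD2r ltr_expR ltr_pM2l.
Qed.

(** * The pressure and the derivative of u p(beta u) *)

(* At [x = 0] the integrand of [pressure] is [ln (0 / 0) = ln 0 = 0], which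
   agrees with [ln (expq 0)], so the integrands coincide everywhere. *)
Lemma pressureE {R : realType} (b : R) :
  pressure b = \int[lebesgue_measure]_(x in `[0, 1]) ln (expq (- b * x)).
Proof.
rewrite /pressure; case: eqVneq => [->|b0].
  under eq_Rintegral do rewrite oppr0 mul0r expq0 ln1.
  by rewrite Rintegral_cst// mul0r.
apply: eq_Rintegral => x _; rewrite /expq mulf_eq0 oppr_eq0 (negbTE b0)/=.
case: eqVneq => [->|x0].
  by rewrite mulr0 invr0 mulr0 ln1 ln0.
by rewrite mulNr invrN mulrN -mulNr opprB.
Qed.

(* The mean is [(H u - H 0) / u] for [H] the integral of [f] from a base point
   far to the left; this base makes [H] differentiable at [0] too. *)
Lemma is_derive_mulr_mean {R : realType} (f : R -> R) (u : R) :
  continuous f ->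
  is_derive u 1
    (fun v => v * \int[lebesgue_measure]_(x in `[0, 1]) f (v * x)) (f u).
Proof.
(* The margin 1 keeps every v near u in ]-c, c[, and with it all v x for x in [0, 1]. *)
move=> cf; pose c := `|u| + 1.
pose H x := \int[lebesgue_measure]_(t in `[- c, x]) f t.
have c0 : 0 < c by rewrite ltr_pwDr.
have intf (g : R -> R) a b : continuous g ->
    lebesgue_measure.-integrable `[a, b] (EFin \o g).
  move=> cg; apply: continuous_compact_integrable; first exact: segment_compact.
  exact: continuous_subspaceT.
have dH (x : R) : - c < x < c -> is_derive x 1 H (f x).
  move=> /andP[cx xc].
  have [] := @continuous_FTC1_closed R f (- c) x c xc (intf _ _ _ cf) cx (cf x).
  move=> dHx HE; apply: DeriveDef; first exact: dHx.
  by rewrite -derive1E; exact: HE.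
have uc : - c < u < c by rewrite -ltr_norml ltrDl.
apply: (@near_eq_is_derive _ _ _ (fun v => H v - H 0)); last first.
  by have dHu := dH u uc; apply: is_derive_eq; rewrite subr0.
near=> v.
have vc : `|v| < c.
  near: v; apply: (@cvgr_lt _ _ (nbhs u) _ (fun v => `|v|) `|u|).
    exact: (@norm_continuous _ R^o).
  by rewrite ltrDl.
have dHv (x : R) : x \in `[0, 1] -> is_derive x 1 (H \o *%R v) (f (v * x) * v).
  rewrite in_itv/= => /andP[x0 x1].
  have dHvx : is_derive (v * x) 1 H (f (v * x)).
    apply: dH; rewrite -ltr_norml normrM (le_lt_trans _ vc)//.
    by rewrite ler_piMr// ger0_norm.
  have dvx : is_derive x 1 ( *%R v) v.
    by apply: is_derive_eq; rewrite [LHS]mulr1.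
  exact: is_derive1_comp.
have cHv (x : R) : x \in `[0, 1] -> {for x, continuous (H \o *%R v)}.
  move=> /dHv ?; apply/differentiable_continuous/derivable1_diffP.
  exact: ex_derive.
have cfv : continuous (fun x => f (v * x)).
  move=> x; apply: (@cvg_comp _ _ _ ( *%R v) f _ (nbhs (v * x))).
    exact: mulrl_continuous.
  exact: cf.
(* The factor v makes H(v x) an antiderivative in x; nothing is divided by v, so v = 0 needs no
   separate case. *)
have FTC : (\int[lebesgue_measure]_(x in `[0%R, 1%R]) (f (v * x) * v)%:E =
           ((H \o *%R v) 1)%:E - ((H \o *%R v) 0)%:E)%E.
  apply: continuous_FTC2 => //.
  - apply: continuous_subspaceT => x; apply: cvgM; last exact: cvg_cst.
    exact: cfv.
  - split.
    + move=> x /subset_itv_oo_cc x01; have ? := dHv x x01; exact: ex_derive.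
    + by apply: cvg_at_right_filter; apply: cHv; rewrite in_itv/= lexx ler01.
    + by apply: cvg_at_left_filter; apply: cHv; rewrite in_itv/= lexx ler01.
  - move=> x /subset_itv_oo_cc x01; have ? := dHv x x01.
    by rewrite derive1E derive_val.
rewrite mulrC -RintegralZr//; last exact: intf.
by rewrite /Rintegral FTC /= mulr1 mulr0.
Unshelve. all: by end_near. Qed.

Lemma is_derive_mulr_pressure {R : realType} (b u : R) :
  is_derive u 1 (fun v => v * pressure (b * v)) (ln (expq (- b * u))).
Proof.
have := @is_derive_mulr_mean R _ u (@continuous_ln_expq R (- b)).
rewrite [X in is_derive _ _ X](_ : _ = fun v => v * pressure (b * v))//.
apply/funext => v; rewrite pressureE; congr (_ * _).
by apply: eq_Rintegral => x _; rewrite mulrA mulNr.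
Qed.

(** * The entropy term *)

(** As [ln] is 0 on nonpositive reals, only 0 is delicate; there x ln x is squeezed between -2
    sqrt|x| and 2 sqrt|x|. This yields continuity of [Phi] at the endpoints of [Idom], where some
    t_ij vanishes. *)
Lemma continuous_xlnx {R : realType} : continuous (fun x : R => x * ln x).
Proof.
move=> x; case: (ltgtP x 0) => [x0|x0|->].
- apply: (@near_cst_continuous _ _ (0 : R)).
  near=> y; rewrite ln0 ?mulr0// ltW//; near: y.
  by apply: (@cvgr_lt _ _ (nbhs x) _ id x); first exact: cvg_id.
- by apply: cvgM; [exact: cvg_id|exact: continuous_ln].
- rewrite /continuous_at mul0r.
  have sqrt0 : 2 * Num.sqrt `|y| @[y --> (0 : R)] --> (0 : R).
    rewrite -[X in _ --> X](mulr0 2); apply: cvgM; first exact: cvg_cst.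
    have e0 : Num.sqrt `|0 : R| = 0 by rewrite normr0 sqrtr0.
    rewrite -[X in _ --> X]e0.
    apply: (@cvg_comp _ _ _ (fun y : R => `|y|) Num.sqrt _ (nbhs `|0 : R|)).
      exact: (@norm_continuous _ R^o).
    exact: sqrt_continuous.
  have Nsqrt0 : - (2 * Num.sqrt `|y|) @[y --> (0 : R)] --> (0 : R).
    by rewrite -[X in _ --> X]oppr0; exact: cvgN.
  apply: (squeeze_cvgr _ Nsqrt0 sqrt0); near=> y; rewrite -ler_norml.
  have [y0|y0] := leP y 0.
    by rewrite ln0// mulr0 normr0 mulr_ge0// sqrtr_ge0.
  have y1 : y < 1.
    by near: y; apply: (@cvgr_lt _ _ (nbhs (0:R)) _ id 0) => //; exact: cvg_id.
  rewrite (gtr0_norm y0) normrM (gtr0_norm y0) ltr0_norm; last first.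
    by rewrite ln_lt0// y0.
  (* - y ln y = 2 s^2 ln (1/s) <= 2 s *)
  set s := Num.sqrt y; have s0 : 0 < s by rewrite sqrtr_gt0.
  have -> : y = s ^+ 2 by rewrite sqr_sqrtr// ltW.
  have := @ln_sublinear R s^-1; rewrite invr_gt0 => /(_ s0).
  rewrite lnV ?posrE// lnXn// => lns.
  have : s * (s * - ln s) <= s * (s * s^-1).
    by rewrite !ler_pM2l// ltW.
  rewrite divff ?gt_eqF// mulr1 => {}lns.
  by rewrite mulr2n; nra.
Unshelve. all: by end_near. Qed.

Lemma entropy_termE {R : realType} (t a : R) : a != 0 ->
  entropy_term t a = a * ((t / a) * ln (t / a)).
Proof. by move=> a0; rewrite /entropy_term mulrA mulrCA mulfV ?mulr1. Qed.

Lemma continuous_entropy_term {R : realType} (a : R) : 0 < a ->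
  continuous (entropy_term ^~ a).
Proof.
move=> a0; have -> : entropy_term ^~ a = fun t => a * ((t / a) * ln (t / a)).
  by apply/funext => t; rewrite entropy_termE ?gt_eqF.
move=> t; apply: cvgM; first exact: cvg_cst.
apply: (@cvg_comp _ _ _ ( *%R^~ a^-1) (fun x => x * ln x) _ (nbhs (t / a))).
  exact: mulrr_continuous.
exact: continuous_xlnx.
Qed.

Lemma is_derive_entropy_term {R : realType} {t a : R} : 0 < t -> 0 < a ->
  is_derive t 1 (entropy_term ^~ a) (ln (t / a) + 1).
Proof.
move=> t0 a0; have ta0 : 0 < t / a by rewrite divr_gt0.
have dta : is_derive t 1 (fun x => x / a) a^-1.
  have := is_deriveM (is_derive_id t 1) (is_derive_cst (a^-1 : R) t 1).
  by rewrite scaler0 add0r [_ *: _]mulr1.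
have dln : is_derive t 1 (@ln R \o (fun x => x / a)) ((t / a)^-1 * a^-1).
  exact: (@is_derive1_comp _ _ ( *%R^~ a^-1) _ _ _ (is_derive1_ln ta0) dta).
have := is_deriveM (is_derive_id t 1) dln.
rewrite [X in is_derive _ _ _ X](_ : _ = ln (t / a) + 1)//.
rewrite [_ *: 1]mulr1 addrC; congr (_ + _).
by rewrite invf_div -[LHS]/(t * (a / t * a^-1)); field; rewrite !gt_eqF.
Qed.

(** * Areas of the rectangles *)

Lemma lebesgue_measure_L1 {R : realType} (a : R) : 0 < a ->
  lebesgue_measure (L1 a) = a%:E.
Proof.
by move=> a0; rewrite /L1 lebesgue_measure_itv/= lte_fin a0 -EFinB subr0.
Qed.

Lemma lebesgue_measure_L2 {R : realType} (a : R) : a < 1 ->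
  lebesgue_measure (L2 a) = (1 - a)%:E.
Proof. by move=> a1; rewrite /L2 lebesgue_measure_itv/= lte_fin a1 -EFinB. Qed.

Lemma areaE {R : realType} (A B : set R) (a b : R) :
  measurable A -> measurable B ->
  lebesgue_measure A = a%:E -> lebesgue_measure B = b%:E ->
  area A B = a * b.
Proof.
by move=> mA mB Aa Bb; rewrite /area product_measure1E//= Aa Bb.
Qed.

(** * Strict convexity from an increasing derivative *)

(** The mean value theorem on both sides of z = l x + (1 - l) y gives c1 < z < c2, and the convexity
    gap is l (1 - l) (y - x) (df c2 - df c1). Continuity lets x and y be endpoints, where no
    derivative is assumed. *)
Lemma strictly_convex_increasing_derive {R : realType} (f df : R -> R)
    (a b : R) :
  continuous f ->
  {in `]a, b[, forall x : R, is_derive x 1 f (df x)} ->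
  {in `]a, b[ &, {homo df : x y / x < y}} ->
  strictly_convex_on `[a, b]%classic f.
Proof.
move=> cf dfE df_incr.
suff H x y l : x \in `[a, b] -> y \in `[a, b] -> x < y -> 0 < l < 1 ->
    f (l * x + (1 - l) * y) < l * f x + (1 - l) * f y.
  move=> x y l /= xab yab xy l01; case: (ltgtP x y) xy => // [xy _|yx _].
    exact: H.
  have := H y x (1 - l) yab xab yx; rewrite subKr => H'.
  rewrite addrC [ltRHS]addrC H'//; lra.
rewrite !in_itv/= => /andP[ax xb] /andP[ay yb] xy /andP[l0 l1].
set z := l * x + (1 - l) * y.
have zx : z - x = (1 - l) * (y - x) by rewrite /z; ring.
have yz : y - z = l * (y - x) by rewrite /z; ring.
have xz : x < z by rewrite -subr_gt0 zx mulr_gt0// subr_gt0.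
have zy : z < y by rewrite -subr_gt0 yz mulr_gt0// subr_gt0.
have dfxy u v : a <= u -> v <= b -> forall c, c \in `]u, v[ -> c \in `]a, b[.
  move=> au vb c; rewrite !in_itv/= => /andP[uc cv].
  by rewrite (le_lt_trans au uc) (lt_le_trans cv vb).
have zb : z <= b by rewrite ltW// (lt_le_trans zy yb).
have az : a <= z by rewrite ltW// (le_lt_trans ax xz).
have [c1 c1xz fzx] := MVT xz (fun c cxz => dfE c (dfxy x z ax zb c cxz))
  (continuous_subspaceT cf).
have [c2 c2zy fyz] := MVT zy (fun c czy => dfE c (dfxy z y az yb c czy))
  (continuous_subspaceT cf).
have c12 : df c1 < df c2.
  apply: df_incr; [exact: dfxy c1xz|exact: dfxy c2zy|].
  move: c1xz c2zy; rewrite !in_itv/= => /andP[_ c1z] /andP[zc2 _].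
  exact: lt_trans zc2.
rewrite -subr_gt0.
rewrite (_ : _ - _ = (1 - l) * (f y - f z) - l * (f z - f x)); last ring.
rewrite fyz fzx zx yz.
rewrite (_ : _ - _ = (1 - l) * l * (y - x) * (df c2 - df c1)); last ring.
by rewrite !mulr_gt0// subr_gt0.
Qed.

(** * Continuity and derivative of [Phi] *)

Lemma is_derive_comp_subl {R : realType} {f : R -> R} {c t d : R} :
  is_derive (c - t) 1 f d -> is_derive t 1 (fun s => f (c - s)) (- d).
Proof.
move=> fd; have ds : is_derive t 1 (fun s : R => c - s) (- 1).
  by have := is_deriveB (is_derive_cst c t 1) (is_derive_id t 1); rewrite sub0r.
rewrite -mulrN1; exact: (@is_derive1_comp _ _ (fun s => c - s)).
Qed.

Lemma is_derive_comp_addl {R : realType} {f : R -> R} {c t d : R} :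
  is_derive (c + t) 1 f d -> is_derive t 1 (fun s => f (c + s)) d.
Proof.
move=> fd; have ds : is_derive t 1 (fun s : R => c + s) 1.
  by have := is_deriveD (is_derive_cst c t 1) (is_derive_id t 1); rewrite add0r.
rewrite -[d]mulr1; exact: (@is_derive1_comp _ _ (fun s => c + s)).
Qed.

(** The contribution to [Phi] that depends on a single t_ij = s, with a = |L_ij|. *)
Definition cell {R : realType} (b a s : R) : R :=
  entropy_term s a + s * pressure (b * s).

Lemma continuous_cell {R : realType} (b a : R) : 0 < a -> continuous (cell b a).
Proof.
move=> a0 s; apply: cvgD; first exact: continuous_entropy_term.
have [/derivable1_diffP/differentiable_continuous] :=
  is_derive_mulr_pressure b s.
exact.
Qed.

Lemma is_derive_cell {R : realType} (b : R) {a s : R} : 0 < a -> 0 < s ->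
  is_derive s 1 (cell b a) (ln (s * expq (- b * s)) - ln a + 1).
Proof.
move=> a0 s0.
have := is_deriveD (is_derive_entropy_term s0 a0) (is_derive_mulr_pressure b s).
rewrite ln_div ?posrE// lnM ?posrE ?expq_gt0//.
rewrite [X in is_derive _ _ _ X](_ : _ =
  ln s + ln (expq (- b * s)) - ln a + 1)//; ring.
Qed.

(** The row and column sums of the t_ij are [th1], [1 - th1], [th2], [1 - th2], free of t, so their
    pressure terms go into K. *)
Lemma PhiE {R : realType} (b th1 th2 : R) : exists K, forall t,
  Phi b th1 th2 t = K
    + (cell b (area (L1 th1) (L1 th2)) t
       + cell b (area (L1 th1) (L2 th2)) (th1 - t)
       + cell b (area (L2 th1) (L1 th2)) (th2 - t)
       + cell b (area (L2 th1) (L2 th2)) (1 - th1 - th2 + t))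
    + b * (th1 - t) * (th2 - t).
Proof.
exists (pressure b - th1 * pressure (b * th1) - th2 * pressure (b * th2)
  - (1 - th2) * pressure (b * (1 - th2))
  - (1 - th1) * pressure (b * (1 - th1))).
move=> t; rewrite /Phi /Phi_tilde /cell.
rewrite (_ : t + (th1 - t) = th1); last ring.
rewrite (_ : t + (th2 - t) = th2); last ring.
rewrite (_ : th1 - t + _ = 1 - th2); last ring.
rewrite (_ : th2 - t + _ = 1 - th1); last ring.
by move: (@pressure R) (@entropy_term R) (@area R) => p e ar; ring.
Qed.

Definition dPhi {R : realType} (b th1 th2 t : R) : R :=
  ln (t * expq (- b * t))
  + ln ((1 - th1 - th2 + t) * expq (- b * (1 - th1 - th2 + t)))
  - ln ((th1 - t) * expq (b * (th1 - t)))
  - ln ((th2 - t) * expq (b * (th2 - t))).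

(** The right side is positivity of t11, t22, t12, t21, as the logarithms require. *)
Lemma Idom_oo {R : realType} (th1 th2 t : R) :
  (t \in `]Num.max 0 (th1 + th2 - 1), Num.min th1 th2[) =
  [&& 0 < t, 0 < 1 - th1 - th2 + t, 0 < th1 - t & 0 < th2 - t].
Proof.
rewrite in_itv/= gt_max lt_min -andbA !subr_gt0; congr (_ && (_ && _)).
by apply/idP/idP; lra.
Qed.

Section Phi_calculus.
Context {R : realType} {b th1 th2 : R}.
Hypotheses (th1_01 : 0 < th1 < 1) (th2_01 : 0 < th2 < 1).

Let th1_gt0 : 0 < th1. Proof. by case/andP: th1_01. Qed.
Let th2_gt0 : 0 < th2. Proof. by case/andP: th2_01. Qed.
Let th1_lt1 : th1 < 1. Proof. by case/andP: th1_01. Qed.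
Let th2_lt1 : th2 < 1. Proof. by case/andP: th2_01. Qed.
Let th1C_gt0 : 0 < 1 - th1. Proof. by rewrite subr_gt0. Qed.
Let th2C_gt0 : 0 < 1 - th2. Proof. by rewrite subr_gt0. Qed.

Lemma area_cells :
  [/\ area (L1 th1) (L1 th2) = th1 * th2,
      area (L1 th1) (L2 th2) = th1 * (1 - th2),
      area (L2 th1) (L1 th2) = (1 - th1) * th2 &
      area (L2 th1) (L2 th2) = (1 - th1) * (1 - th2)].
Proof.
by split; apply: areaE; rewrite ?lebesgue_measure_L1 ?lebesgue_measure_L2//;
  exact: measurable_itv.
Qed.

Lemma continuous_Phi : continuous (Phi b th1 th2).
Proof.
have [K eqPhi] := PhiE b th1 th2.
rewrite (funext eqPhi).
have [-> -> -> ->] := area_cells.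
have csub c : continuous (fun s : R => c - s).
  by move=> s; apply: cvgB; [exact: cvg_cst|exact: cvg_id].
have cadd c : continuous (fun s : R => c + s).
  by move=> s; apply: cvgD; [exact: cvg_cst|exact: cvg_id].
have ccomp (f g : R -> R) : continuous f -> continuous g -> continuous (f \o g).
  by move=> cf cg s; apply: continuous_comp; [exact: cg|exact: cf].
move=> t; apply: cvgD; last first.
  by apply: cvgM; [apply: cvgM; [exact: cvg_cst|exact: csub]|exact: csub].
apply: cvgD; first exact: cvg_cst.
apply: cvgD; [apply: cvgD; [apply: cvgD|]|].
- by apply: continuous_cell; rewrite mulr_gt0.
- apply: (ccomp (cell b _) (fun s => th1 - s)) => //.
  by apply: continuous_cell; rewrite mulr_gt0.
- apply: (ccomp (cell b _) (fun s => th2 - s)) => //.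
  by apply: continuous_cell; rewrite mulr_gt0.
- apply: (ccomp (cell b _) (fun s => 1 - th1 - th2 + s)) => //.
  by apply: continuous_cell; rewrite mulr_gt0.
Qed.

Lemma is_derive_Phi (t : R) :
  t \in `]Num.max 0 (th1 + th2 - 1), Num.min th1 th2[ ->
  is_derive t 1 (Phi b th1 th2) (dPhi b th1 th2 t).
Proof.
rewrite Idom_oo => /and4P[t11 t22 t12 t21].
have [K eqPhi] := PhiE b th1 th2.
rewrite (funext eqPhi).
have [-> -> -> ->] := area_cells.
have d11 := is_derive_cell b (mulr_gt0 th1_gt0 th2_gt0) t11.
have d12 := is_derive_comp_subl
  (is_derive_cell b (mulr_gt0 th1_gt0 th2C_gt0) t12).
have d21 := is_derive_comp_subl
  (is_derive_cell b (mulr_gt0 th1C_gt0 th2_gt0) t21).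
have d22 := is_derive_comp_addl
  (is_derive_cell b (mulr_gt0 th1C_gt0 th2C_gt0) t22).
have dsub (c : R) : is_derive t 1 (fun s : R => c - s) (- 1).
  by apply: is_derive_comp_subl; exact: is_derive_id.
have dM : is_derive t 1 (fun s : R => b * (th1 - s) * (th2 - s))
    (- (b * (th1 - t)) - b * (th2 - t)).
  have := is_deriveM (is_deriveM (is_derive_cst b t 1) (dsub th1)) (dsub th2).
  rewrite [X in is_derive _ _ _ X -> _](_ : _ =
    b * (th1 - t) * -1 + (th2 - t) * (b * -1 + (th1 - t) * 0))//.
  by rewrite !mulrN1 mulr0 addr0 mulrN (mulrC _ b).
have := is_deriveD (is_deriveD (is_derive_cst K t 1)
  (is_deriveD (is_deriveD (is_deriveD d11 d12) d21) d22)) dM.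
rewrite [X in is_derive _ _ _ X -> _](_ : _ = dPhi b th1 th2 t)//.
(* The cells enter with signs +, -, -, +, so the constants 1 and the logarithms of the areas cancel.
   The derivative -b t12 - b t21 of the cross term is what [ln_expqN] supplies. *)
rewrite /dPhi !lnM ?posrE ?expq_gt0//.
rewrite (ln_expqN (b * (th1 - t))) (ln_expqN (b * (th2 - t))) !mulNr.
ring.
Qed.

Lemma dPhi_increasing :
  {in `]Num.max 0 (th1 + th2 - 1), Num.min th1 th2[ &,
    {homo dPhi b th1 th2 : s t / s < t}}.
Proof.
move=> s t; rewrite !Idom_oo.
move=> /and4P[s11 s22 s12 s21] /and4P[t11 t22 t12 t21] st.
rewrite /dPhi ltrB// ?ltrB// ?ltrD//; apply: ln_mulr_expq_increasing => //; lra.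
Qed.

End Phi_calculus.

(** * The critical point *)

(** Dividing by b absorbs its sign, so later comparisons treat b > 0 and b < 0 together. *)
Lemma ltr_expR_div {R : realType} (b x y : R) : b != 0 ->
  (x < y) = (0 < (expR (- (b * x)) - expR (- (b * y))) / b).
Proof.
move=> b0; case: (ltgtP b 0) b0 => // b0 _.
- by rewrite nmulr_lgt0 ?invr_lt0// subr_lt0 ltr_expR ltrN2 ltr_nM2l.
- by rewrite pmulr_lgt0 ?invr_gt0// subr_gt0 ltr_expR ltrN2 ltr_pM2l.
Qed.

Section critical_point.
Context {R : realType} {b th1 th2 : R}.
Hypotheses (th1_01 : 0 < th1 < 1) (th2_01 : 0 < th2 < 1).

Let th1_gt0 : 0 < th1. Proof. by case/andP: th1_01. Qed.
Let th2_gt0 : 0 < th2. Proof. by case/andP: th2_01. Qed.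
Let th1_lt1 : th1 < 1. Proof. by case/andP: th1_01. Qed.
Let th2_lt1 : th2 < 1. Proof. by case/andP: th2_01. Qed.

Let A := expR (- (b * th1)).
Let B := expR (- (b * th2)).
Let E := expR (- b).

Let ltE (x y : R) : b != 0 ->
  (x < y) = (0 < (expR (- (b * x)) - expR (- (b * y))) / b).
Proof. exact: ltr_expR_div. Qed.

(** Here and below: A and B lie strictly between E and 1, in a form independent of the sign of b. *)
Let A1 : b != 0 -> 0 < (1 - A) / b.
Proof.
by move=> b0; have := ltE 0 th1 b0;
  rewrite mulr0 oppr0 expR0 th1_gt0.
Qed.
Let B1 : b != 0 -> 0 < (1 - B) / b.
Proof.
by move=> b0; have := ltE 0 th2 b0;
  rewrite mulr0 oppr0 expR0 th2_gt0.
Qed.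
Let EA : b != 0 -> 0 < (A - E) / b.
Proof.
by move=> b0; have := ltE th1 1 b0;
  rewrite mulr1 th1_lt1.
Qed.
Let EB : b != 0 -> 0 < (B - E) / b.
Proof.
by move=> b0; have := ltE th2 1 b0;
  rewrite mulr1 th2_lt1.
Qed.
Let E1 : b != 0 -> 0 < (1 - E) / b.
Proof.
by move=> b0; have := ltE 0 1 b0;
  rewrite mulr0 oppr0 expR0 mulr1 ltr01.
Qed.
Let E1_neq0 : b != 0 -> 1 - E != 0.
Proof. by move=> /E1; apply: contraTneq => ->; rewrite mul0r ltxx. Qed.

Lemma expR_Rcrit : b != 0 ->
  expR (- (b * Rcrit b th1 th2)) = 1 - (1 - A) * (1 - B) / (1 - E).
Proof.
move=> b0; rewrite /Rcrit (negbTE b0) mulNr mulrN opprK mulVKf// lnK// posrE.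
rewrite -/A -/B -/E.
(* Positivity of the argument of [ln], from 1 - E - (1 - A)(1 - B) = A (1 - B) + (B - E). *)
rewrite (_ : _ - _ = (A * ((1 - B) / b) + (B - E) / b) / ((1 - E) / b)).
  by rewrite divr_gt0 ?E1// addr_gt0 ?EB// mulr_gt0 ?B1// expR_gt0.
by field; rewrite b0 E1_neq0.
Qed.

Lemma Rcrit_Idom :
  Rcrit b th1 th2 \in `]Num.max 0 (th1 + th2 - 1), Num.min th1 th2[.
Proof.
rewrite Idom_oo; case: (eqVneq b 0) => [b0|b0].
  (* At b = 0 the four t_ij are the areas of the rectangles. *)
  have [th1C th2C] : 0 < 1 - th1 /\ 0 < 1 - th2 by rewrite !subr_gt0.
  rewrite /Rcrit b0 eqxx (_ : 1 - _ - _ + _ = (1 - th1) * (1 - th2)); last ring.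
  rewrite (_ : th1 - _ = th1 * (1 - th2)); last ring.
  rewrite (_ : th2 - _ = th2 * (1 - th1)); last ring.
  by rewrite !mulr_gt0.
set t := Rcrit _ _ _; have tE : expR (- (b * t)) = _ := expR_Rcrit b0.
move: (A1 b0) (B1 b0) (EA b0) (EB b0) (E1 b0) (E1_neq0 b0).
move=> a1 b1 ea eb e1 e1_neq0.
(* Each inequality is compared through e^(-b s); the differences factor into quantities of known
   sign. *)
apply/and4P; split.
- rewrite ltE// mulr0 oppr0 expR0 tE.
  rewrite (_ : _ / b = (1 - A) / b * ((1 - B) / b) / ((1 - E) / b)).
    by rewrite divr_gt0// mulr_gt0.
  by field; rewrite b0.
- rewrite (_ : _ + t = t - (th1 + th2 - 1)); last ring.
  rewrite subr_gt0 ltE// tE.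
  rewrite (_ : - (b * _) = - (b * th1) - b * th2 - - b); last ring.
  rewrite !expRD (expRN (- b)) -/A -/B -/E.
  rewrite (_ : _ / b = (A - E) / b * ((B - E) / b) / ((1 - E) / b) / E).
    by rewrite divr_gt0 ?expR_gt0// divr_gt0// mulr_gt0.
  by field; rewrite b0 e1_neq0 gt_eqF// expR_gt0.
- rewrite subr_gt0 ltE// tE -/A.
  rewrite (_ : _ / b = (1 - A) / b * ((B - E) / b) / ((1 - E) / b)).
    by rewrite divr_gt0// mulr_gt0.
  by field; rewrite b0.
- rewrite subr_gt0 ltE// tE -/B.
  rewrite (_ : _ / b = (1 - B) / b * ((A - E) / b) / ((1 - E) / b)).
    by rewrite divr_gt0// mulr_gt0.
  by field; rewrite b0.
Qed.

Lemma dPhi_eq0 {t : R} :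
  t \in `]Num.max 0 (th1 + th2 - 1), Num.min th1 th2[ ->
  dPhi b th1 th2 t = 0 <-> t = Rcrit b th1 th2.
Proof.
rewrite Idom_oo => /and4P[t11 t22 t12 t21].
have step1 : dPhi b th1 th2 t = 0 <->
    (t * expq (- b * t))
      * ((1 - th1 - th2 + t) * expq (- b * (1 - th1 - th2 + t)))
    = ((th1 - t) * expq (b * (th1 - t))) * ((th2 - t) * expq (b * (th2 - t))).
  have pos s c : 0 < s -> s * expq (c * s) \is Num.pos.
    by move=> s0; rewrite posrE mulr_gt0// expq_gt0.
  rewrite /dPhi -lnM ?pos// -addrA -opprD -lnM ?pos//.
  split=> [/eqP|->]; last by rewrite subrr.
  by rewrite subr_eq0 => /eqP/ln_inj -> //; rewrite rpredM ?pos.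
rewrite step1; case: (eqVneq b 0) => [b0|b0].
  (* The equation is t (1 - th1 - th2 + t) = (th1 - t)(th2 - t); all but t = th1 th2 cancels. *)
  rewrite !mulr_expqM /Rcrit b0 oppr0 eqxx; split; nra.
rewrite !mulr_expqM oppr_eq0 (negbTE b0).
set a := expR (- b * t).
have a0 : a != 0 by rewrite gt_eqF// expR_gt0.
have A0 : A != 0 by rewrite gt_eqF// expR_gt0.
have B0 : B != 0 by rewrite gt_eqF// expR_gt0.
have -> : expR (- b * (1 - th1 - th2 + t)) = a * E / (A * B).
  by rewrite -expRD -expRD -expRN -expRD; congr expR; ring.
have -> : expR (b * (th1 - t)) = a / A.
  by rewrite -expRN -expRD; congr expR; ring.
have -> : expR (b * (th2 - t)) = a / B.
  by rewrite -expRN -expRD; congr expR; ring.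
have step2 : t = Rcrit b th1 th2 <-> a = 1 - (1 - A) * (1 - B) / (1 - E).
  rewrite -expR_Rcrit// /a mulNr; split=> [->//|/expR_inj/oppr_inj].
  exact: mulfI.
rewrite step2.
(* The constant terms in a cancel, leaving a times a linear factor whose root is e^(-b R); the
   remaining factors are nonzero. *)
have gap : (a - 1) / - b * ((a * E / (A * B) - 1) / - b)
    - (a / A - 1) / b * ((a / B - 1) / b)
  = - (a - (1 - (1 - A) * (1 - B) / (1 - E))) * a * (1 - E) / (A * B * b ^+ 2).
  by field; rewrite b0 A0 B0 E1_neq0.
split=> [/eqP|ae].
  rewrite -subr_eq0 gap !mulf_eq0 invr_eq0 !mulf_eq0 oppr_eq0.
  rewrite (negbTE a0) (negbTE A0) (negbTE B0) (negbTE b0).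
  by rewrite (negbTE (E1_neq0 b0)) !orbF subr_eq0 => /eqP.
apply/eqP; rewrite -subr_eq0 gap {1}ae subrr oppr0 !mul0r//.
Qed.

End critical_point.

Theorem theorem3p10 (R : realType) (beta theta1 theta2 : R)
    (htheta1 : 0 < theta1 < 1) (htheta2 : 0 < theta2 < 1) :
  strictly_convex_on (Idom theta1 theta2) (Phi beta theta1 theta2) /\
  (forall t : R,
     critical_point (Idom theta1 theta2) (Phi beta theta1 theta2) t <->
     t = Rcrit beta theta1 theta2).
Proof.
split.
  apply: (@strictly_convex_increasing_derive _ _ (dPhi beta theta1 theta2)).
  - exact: continuous_Phi.
  - by move=> t tI; exact: is_derive_Phi.
  - exact: dPhi_increasing.
move=> t; rewrite /critical_point /Idom interior_itv_bnd; split.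
  move=> [tI dt]; apply/(@dPhi_eq0 _ beta theta1 _ htheta2 _ tI).
  have dt' := @is_derive_Phi _ beta _ _ htheta1 htheta2 _ tI.
  (* Uniqueness of the derivative identifies [dPhi] at t with 0. *)
  by rewrite -(@derive_val _ _ _ _ _ _ _ dt') (@derive_val _ _ _ _ _ _ _ dt).
move=> tE.
have tI : t \in `]Num.max 0 (theta1 + theta2 - 1), Num.min theta1 theta2[.
  by rewrite tE; exact: Rcrit_Idom.
split; first exact: tI.
have := @is_derive_Phi _ beta _ _ htheta1 htheta2 _ tI.
by rewrite (proj2 (dPhi_eq0 htheta2 tI) tE).
Qed.
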